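(* Let $X$ be a separable smooth Banach space over $\mathbb{C}$, and let $T\in B(X)$ be self-adjoint. Then $\sigma_{eig}(T)$ is countable.
   Context: $B(X)$ is the space of bounded linear operators on $X$, $S_X=\{x\in X:\|x\|=1\}$, $X^*$ is the space of bounded linear functionals on $X$. $X$ is smooth if every $x\in S_X$ admits a unique $x^*\in S_{X^*}$ with $x^*(x)=1$. The duality mapping $J:X\to X^*$ of a smooth Banach space assigns to each $x$ the unique functional $J(x)$ with $\|J(x)\|=\|x\|$ and $J(x)(x)=\|x\|^2$. For $T\in B(X)$ the transpose $T':X^*\to X^*$ is $(T'f)(x)=f(Tx)$. $T\in B(X)$ is self-adjoint if $T'\circ J=J\circ T$. The eigenspectrum $\sigma_{eig}(T)$ is the set of $\lambda\in\mathbb{C}$ such that $T-\lambda I$ is not injective. Countable means finite or countably infinite. *)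

(* Defs.v *)
From HB Require Import structures.
From mathcomp Require Import all_boot all_order all_algebra.
From mathcomp Require Import complex.
From mathcomp Require Import boolp classical_sets functions cardinality reals.
From mathcomp Require Import topology normedtype.

Set Implicit Arguments.
Unset Strict Implicit.
Unset Printing Implicit Defensive.

Import Order.TTheory GRing.Theory Num.Theory.
Import numFieldNormedType.Exports.

Local Open Scope classical_set_scope.
Local Open Scope ring_scope.

Record bounded_op (K : numFieldType) (X Y : normedModType K) := BoundedOp {
  bounded_op_fun :> {linear X -> Y};
  bounded_opP : bounded_near bounded_op_fun (nbhs (0 : X)) }.

HB.instance Definition _ (K : numFieldType) (X Y : normedModType K) :=
  gen_eqMixin (bounded_op X Y).
HB.instance Definition _ (K : numFieldType) (X Y : normedModType K) :=
  gen_choiceMixin (bounded_op X Y).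

Lemma bounded_op_eq (K : numFieldType) (X Y : normedModType K)
  (f g : bounded_op X Y) : f =1 g -> f = g.
Proof.
case: f g => [f fb] [g gb] /= fg.
have E : f = g.
  case: f g fg {fb gb} => [f [[f1] [f2]]] [g [[g1] [g2]]] /= fg.
  have {}fg : f = g by apply/funext.
  case: _ / fg in g1 g2 *.
  by rewrite (Prop_irrelevance f1 g1) (Prop_irrelevance f2 g2).
case: _ / E in gb *; by rewrite (Prop_irrelevance fb gb).
Qed.

Fact bounded_op0_subproof (K : numFieldType) (X Y : normedModType K) :
  bounded_near (\0 : {linear X -> Y}) (nbhs (0 : X)).
Proof.
by apply: continuous_linear_bounded; exact: cst_continuous.
Qed.

Definition bounded_op0 (K : numFieldType) (X Y : normedModType K) :=
  BoundedOp (@bounded_op0_subproof K X Y).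

Fact bounded_op_scale_subproof (K : numFieldType) (X Y : normedModType K)
  (a : K) (f : bounded_op X Y) :
  bounded_near (a \*: f : {linear X -> Y}) (nbhs (0 : X)).
Proof.
apply: continuous_linear_bounded; apply: cvgZr; rewrite ?/continuous_at.
exact: (bounded_linear_continuous (bounded_opP f)).
Qed.

Definition bounded_op_scale (K : numFieldType) (X Y : normedModType K)
  (a : K) (f : bounded_op X Y) := BoundedOp (bounded_op_scale_subproof a f).

Fact bounded_op_comp_subproof (K : numFieldType) (X Y Z : normedModType K)
  (g : bounded_op Y Z) (f : bounded_op X Y) :
  bounded_near (g \o f : {linear X -> Z}) (nbhs (0 : X)).
Proof.
apply: continuous_linear_bounded; apply: continuous_comp.
  exact: (bounded_linear_continuous (bounded_opP f)).
exact: (bounded_linear_continuous (bounded_opP g)).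
Qed.

Definition bounded_op_comp (K : numFieldType) (X Y Z : normedModType K)
  (g : bounded_op Y Z) (f : bounded_op X Y) : bounded_op X Z :=
  BoundedOp (bounded_op_comp_subproof g f).

Definition dual (K : numFieldType) (X : normedModType K) :=
  bounded_op X (K^o : normedModType K).

Definition transpose (K : numFieldType) (X : normedModType K)
  (T : bounded_op X X) (f : dual X) : dual X := bounded_op_comp f T.

(* The library norm of a normed module over R[i] takes its values in R[i], on
   the nonnegative real axis; suprema are only available in R. *)
Definition rnorm (R : realType) (X : normedModType R[i]) (x : X) : R :=
  complex.Re `|x|.

Definition op_norm (R : realType) (X Y : normedModType R[i])
  (T : bounded_op X Y) : R :=
  sup [set rnorm (T x) | x in [set x : X | rnorm x <= 1]].

Lemma rnormE (R : realType) (X : normedModType R[i]) (x : X) :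
  `|x| = (rnorm x)%:C%C.
Proof. by rewrite /rnorm RRe_real // normr_real. Qed.

Lemma rnorm_ge0 (R : realType) (X : normedModType R[i]) (x : X) :
  0 <= rnorm x.
Proof. by have := normr_ge0 x; rewrite rnormE lecR. Qed.

Lemma rnorm0 (R : realType) (X : normedModType R[i]) : rnorm (0 : X) = 0.
Proof. by rewrite /rnorm normr0. Qed.

Lemma rnorm0_eq0 (R : realType) (X : normedModType R[i]) (x : X) :
  rnorm x = 0 -> x = 0.
Proof. by move=> x0; apply/normr0_eq0; rewrite rnormE x0. Qed.

Lemma rnormZ (R : realType) (X : normedModType R[i]) (a : R) (x : X) :
  0 <= a -> rnorm (a%:C%C *: x) = a * rnorm x.
Proof.
move=> a0; have : `|a%:C%C *: x| = (a * rnorm x)%:C%C.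
  by rewrite normrZ ger0_norm ?lecR// rnormE rmorphM.
by rewrite rnormE => /complexI.
Qed.

Lemma op_norm_has_sup (R : realType) (X Y : normedModType R[i])
  (T : bounded_op X Y) :
  has_sup [set rnorm (T x) | x in [set x : X | rnorm x <= 1]].
Proof.
split; first by exists (rnorm (T 0)), 0 => //=; rewrite rnorm0.
have /linear_boundedP[M [Mr MT]] := bounded_opP T.
set m := `|complex.Re M| + 1; have m0 : 0 <= m by rewrite addr_ge0.
exists m => _ [x /= x1 <-].
have /MT/(_ x) : M < m%:C%C.
  by rewrite -[M]RRe_real// ltcR (le_lt_trans (ler_norm _))// ltrDl.
by rewrite !rnormE -rmorphM lecR => /le_trans; apply; exact: ler_piMr.
Qed.

Lemma op_norm_ub (R : realType) (X Y : normedModType R[i])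
  (T : bounded_op X Y) (x : X) : rnorm (T x) <= op_norm T * rnorm x.
Proof.
have [/rnorm0_eq0 -> | x0] := eqVneq (rnorm x) 0.
  by rewrite linear0 !rnorm0 mulr0.
have xp : 0 < rnorm x by rewrite lt_neqAle eq_sym x0 rnorm_ge0.
rewrite -ler_pdivrMr// mulrC -rnormZ ?invr_ge0 ?rnorm_ge0// -linearZ.
apply: ub_le_sup; first by case: (op_norm_has_sup T).
exists ((rnorm x)^-1%:C%C *: x) => //=.
by rewrite rnormZ ?invr_ge0 ?rnorm_ge0// mulVf.
Qed.

Lemma op_norm_le (R : realType) (X Y : normedModType R[i])
  (T : bounded_op X Y) (M : R) : 0 <= M ->
  (forall x, rnorm (T x) <= M * rnorm x) -> op_norm T <= M.
Proof.
move=> M0 TM; apply: ge_sup; first by case: (op_norm_has_sup T).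
by move=> _ [x /= x1 <-]; apply: le_trans (TM x) _; exact: ler_piMr.
Qed.

Lemma op_norm_ge0 (R : realType) (X Y : normedModType R[i])
  (T : bounded_op X Y) : 0 <= op_norm T.
Proof.
rewrite -(rnorm0 Y) -(linear0 T); apply: ub_le_sup.
  by case: (op_norm_has_sup T).
by exists 0 => //=; rewrite rnorm0.
Qed.

Lemma op_norm_scale (R : realType) (X Y : normedModType R[i])
  (a : R) (T : bounded_op X Y) : 0 <= a ->
  op_norm (bounded_op_scale a%:C%C T) = a * op_norm T.
Proof.
have H (b : R) (S : bounded_op X Y) : 0 <= b ->
    op_norm (bounded_op_scale b%:C%C S) <= b * op_norm S.
  move=> b0; apply: op_norm_le => [|x]; first by rewrite mulr_ge0 ?op_norm_ge0.
  by rewrite /= rnormZ// -mulrA ler_wpM2l ?op_norm_ub.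
move=> a0; apply/eqP; rewrite eq_le H//=.
have [-> | an0] := eqVneq a 0; first by rewrite mul0r op_norm_ge0.
have ap : 0 < a by rewrite lt_neqAle eq_sym an0.
rewrite mulrC -ler_pdivlMr// mulrC.
have := H a^-1 (bounded_op_scale a%:C%C T); rewrite invr_ge0 => /(_ a0).
congr (_ <= _); congr op_norm; apply: bounded_op_eq => x /=.
by rewrite scalerA -rmorphM mulVf// scale1r.
Qed.

Definition smooth (R : realType) (X : normedModType R[i]) : Prop :=
  forall x : X, rnorm x = 1 -> exists! f : dual X, op_norm f = 1 /\ f x = 1.

Definition is_duality_value (R : realType) (X : normedModType R[i])
  (x : X) (f : dual X) : Prop :=
  op_norm f = rnorm x /\ f x = `|x| ^+ 2.

(* The default 0 is never used when X is smooth, see [duality_mapP]. *)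
Definition duality_map (R : realType) (X : normedModType R[i]) (x : X) :
  dual X := xget (bounded_op0 _ _) (is_duality_value x).

Lemma duality_value_exists_unique (R : realType) (X : normedModType R[i]) :
  smooth X -> forall x : X, exists! f : dual X, is_duality_value x f.
Proof.
move=> Xs x; have [r0 | r0] := eqVneq (rnorm x) 0.
  rewrite (rnorm0_eq0 r0); exists (bounded_op0 _ _); split.
    split; last by rewrite /= normr0 expr0n.
    rewrite rnorm0; apply/eqP; rewrite eq_le op_norm_ge0 andbT.
    by apply: op_norm_le => // y; rewrite /= rnorm0 mul0r.
  move=> f [f0 _]; apply: bounded_op_eq => y; apply/esym/rnorm0_eq0/eqP.
  by rewrite eq_le rnorm_ge0 andbT (le_trans (op_norm_ub f y))// f0 rnorm0 mul0r.
have rx := rnorm_ge0 x; set r := rnorm x in r0 rx.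
have rC : r%:C%C != 0 :> R[i] by rewrite fmorph_eq0.
have [|u [[u1 ux] uu]] := Xs (r^-1%:C%C *: x).
  by rewrite rnormZ ?invr_ge0// mulVf.
exists (bounded_op_scale r%:C%C u); split.
  split; first by rewrite op_norm_scale// u1 mulr1.
  move: ux; rewrite linearZ /= rnormE -/r fmorphV.
  move=> /(canRL (scalerK _)); rewrite invr_eq0 invrK => /(_ rC) ->.
  by rewrite expr2 /GRing.scale /= mulr1.
move=> f [f1 fx].
rewrite (uu (bounded_op_scale r^-1%:C%C f)).
  by apply: bounded_op_eq => y /=; rewrite fmorphV scalerA mulfV// scale1r.
split; first by rewrite op_norm_scale ?invr_ge0// f1 mulVf.
rewrite /= linearZ /= fx rnormE -/r fmorphV expr2 /GRing.scale /=.
by rewrite mulKf// mulVf.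
Qed.

Lemma duality_mapP (R : realType) (X : normedModType R[i]) : smooth X ->
  forall x : X, is_duality_value x (duality_map x).
Proof.
move=> Xs x; have [f [fx _]] := duality_value_exists_unique Xs x.
exact: (xgetI _ fx).
Qed.

Definition self_adjoint (R : realType) (X : normedModType R[i])
  (T : bounded_op X X) : Prop :=
  transpose T \o @duality_map R X = @duality_map R X \o T.

Definition separable (T : topologicalType) : Prop :=
  exists2 A : set T, countable A & dense A.

Definition eigenspectrum (K : numFieldType) (X : normedModType K)
  (T : bounded_op X X) : set K :=
  [set l | ~ injective (fun x : X => T x - l *: x)].

(* Main.v *)
Require Import Defs.
From mathcomp Require Import all_boot all_order all_algebra.
From mathcomp Require Import complex.
From mathcomp Require Import boolp classical_sets functions cardinality reals.
From mathcomp Require Import topology normedtype.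

(** Eigenvectors of a self-adjoint operator for distinct eigenvalues are
    orthogonal in the sense of the duality map, and orthogonal unit vectors lie
    at distance at least 1, so a separable space has room for only countably
    many of them.

    Smoothness makes the duality map conjugate-homogeneous
    ([duality_map_scale]): both sides of [J (c x) = c^* J x] are duality values
    at [c x].  Self-adjointness then gives, for [T x = l x] and [T y = m y],
    the identity [l * J y x = J y (T x) = J (T y) x = m^* * J y x]
    ([eigen_duality_map]).  Taking [x = y] shows that eigenvalues are real, and
    for [l != m] the functional [J y] therefore kills [x].  Since [J y] has norm
    [|y|] and takes the value [|y| ^ 2] at [y - x], it follows that
    [|y| <= |y - x|] ([ler_norm_orthogonal]).  Finally, in a separable space
    every family of uniformly separated points is countable
    ([separable_separated_countable]). *)

Set Implicit Arguments.
Unset Strict Implicit.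
Unset Printing Implicit Defensive.

Import Order.TTheory GRing.Theory Num.Theory.
Import numFieldNormedType.Exports.

Local Open Scope classical_set_scope.
Local Open Scope ring_scope.

(** Each point of the family is within [e / 2] of some point of a countable
    dense set; separation makes this assignment injective. *)
Lemma separable_separated_countable (K : numFieldType)
  (X : pseudoMetricType K) (I : Type) (D : set I) (u : I -> X) (e : K) :
  0 < e -> separable X ->
  (forall i j, D i -> D j -> i <> j -> ~ ball (u i) e (u j)) -> countable D.
Proof.
move=> e0 [A /countable_injP[g ginj] Adense] usep.
have /choice[a aP] (i : I) : exists a, A a /\ ball (u i) (e / 2) a.
  have ui : (ball (u i) (e / 2))° !=set0.
    by exists (u i); apply: nbhsx_ballx; rewrite divr_gt0.
  have [a [/interior_subset ua Aa]] := Adense _ ui (@open_interior _ _).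
  by exists a.
apply/countable_injP; exists (g \o a) => i j.
rewrite !in_setE => Di Dj /= gij; apply: contrapT => /(usep _ _ Di Dj); apply.
have [[Ai ui] [Aj uj]] := (aP i, aP j).
have aij : a i = a j by apply: ginj gij; rewrite in_setE.
by apply: (@ball_splitl _ _ (a i)); rewrite // aij.
Qed.

Section DualityMap.
Variables (R : realType) (X : normedModType R[i]).
Implicit Types (x y : X) (f : dual X).

(** The bound alone suffices for the norm of a duality value: the value at [x]
    shows that the bound is attained. *)
Lemma is_duality_value_bound x f :
  (forall y, rnorm (f y) <= rnorm x * rnorm y) -> f x = `|x| ^+ 2 ->
  is_duality_value x f.
Proof.
move=> fub fx; split => //; apply/eqP; rewrite eq_le op_norm_le ?rnorm_ge0//=.
have [->|x0] := eqVneq (rnorm x) 0; first exact: op_norm_ge0.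
have xp : 0 < rnorm x by rewrite lt_neqAle eq_sym x0 rnorm_ge0.
rewrite -(ler_pM2r xp); apply: le_trans (op_norm_ub f x).
by rewrite -lecR -(rnormE (f x)) fx normrX normr_id rnormE rmorphM expr2.
Qed.

Hypothesis Xs : smooth X.
Local Notation J := (@duality_map R X).

Lemma duality_map_bound x y : `|J x y| <= `|x| * `|y|.
Proof.
have [Jx _] := duality_mapP Xs x.
by rewrite !rnormE -rmorphM lecR -Jx op_norm_ub.
Qed.

Lemma duality_map_unique x f : is_duality_value x f -> f = J x.
Proof.
move=> fx; have [h [_ hu]] := duality_value_exists_unique Xs x.
by rewrite -(hu _ fx); apply: hu; exact: duality_mapP.
Qed.

Lemma duality_map_scale (c : R[i]) x y : J (c *: x) y = c^*%C * J x y.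
Proof.
rewrite -(@duality_map_unique _ (bounded_op_scale c^*%C (J x)))//.
apply: is_duality_value_bound => [z|] /=.
  rewrite -lecR rmorphM /= -!rnormE !normrZ normcJ -mulrA.
  by rewrite ler_wpM2l// duality_map_bound.
rewrite linearZ /= (duality_mapP Xs x).2 normrZ exprMn sqr_normc.
by rewrite /GRing.scale /= mulrCA mulrA.
Qed.

(** Orthogonality in the sense of Birkhoff and James: [J y] takes the same
    value at [y] and at [y - x]. *)
Lemma ler_norm_orthogonal x y : J y x = 0 -> `|y| <= `|y - x|.
Proof.
move=> yx; have [->|y0] := eqVneq y 0; first by rewrite normr0.
have yp : 0 < `|y| by rewrite normr_gt0.
rewrite -(ler_pM2l yp); apply: le_trans (duality_map_bound y (y - x)).
by rewrite linearB yx subr0 (duality_mapP Xs y).2 normrX normr_id expr2.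
Qed.

Variable T : bounded_op X X.
Hypothesis Tsa : self_adjoint T.

Lemma eigen_duality_map (l m : R[i]) x y : T x = l *: x -> T y = m *: y ->
  l * J y x = m^*%C * J y x.
Proof.
move=> Tx Ty; rewrite -duality_map_scale -Ty.
by rewrite -[J (T y)](congr1 (fun F => F y) Tsa) /= Tx linearZ.
Qed.

Lemma eigenvalue_conj (l : R[i]) x : x != 0 -> T x = l *: x -> l^*%C = l.
Proof.
move=> x0 Tx; have Jx : J x x != 0.
  by rewrite (duality_mapP Xs x).2 expf_neq0// normr_eq0.
by apply: (mulIf Jx); rewrite -(eigen_duality_map Tx Tx).
Qed.

Lemma eigen_orthogonal (l m : R[i]) x y : y != 0 ->
  T x = l *: x -> T y = m *: y -> l <> m -> J y x = 0.
Proof.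
move=> y0 Tx Ty /eqP lm; apply/eqP; apply: contraNT lm => yx.
by apply/eqP/(mulIf yx); rewrite (eigen_duality_map Tx Ty) (eigenvalue_conj y0).
Qed.

End DualityMap.

Lemma eigenspectrum_unit (R : realType) (X : normedModType R[i])
  (T : bounded_op X X) (l : R[i]) : eigenspectrum T l ->
  exists x : X, `|x| = 1 /\ T x = l *: x.
Proof.
move=> Tl; apply: contrapT => nex; apply: Tl => x y Txy; apply: contrapT.
move=> /eqP; rewrite -subr_eq0 => xy; apply: nex.
have Tv : T (x - y) = l *: (x - y).
  rewrite linearB scalerBr -[T x](subrK (l *: x)) Txy -(addrA (T y)).
  by rewrite addrAC subrr add0r addrC.
exists (`|x - y|^-1 *: (x - y)); split.
  by rewrite normrZ normfV normr_id mulVf ?normr_eq0.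
by rewrite linearZ /= Tv !scalerA mulrC.
Qed.

Theorem proposition15 (R : realType) (X : completeNormedModType R[i])
  (Xseparable : separable X) (Xsmooth : smooth X)
  (T : bounded_op X X) (Tself_adjoint : self_adjoint T) :
  countable (eigenspectrum T).
Proof.
have /choice[v vP] (l : R[i]) : exists x : X,
    eigenspectrum T l -> `|x| = 1 /\ T x = l *: x.
  have [/eigenspectrum_unit[x xP]|nl] := pselect (eigenspectrum T l).
    by exists x.
  by exists 0.
apply: (separable_separated_countable ltr01 Xseparable (u := v)) => l m Tl Tm lm.
have [_ vl] := vP _ Tl; have [vm1 vm] := vP _ Tm.
have vm0 : v m != 0 by rewrite -normr_eq0 vm1 oner_neq0.
rewrite -ball_normE /= distrC => /lt_geF.
rewrite -vm1 ler_norm_orthogonal//.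
exact: (eigen_orthogonal Xsmooth Tself_adjoint vm0 vl vm lm).
Qed.
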